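(* Assume that $\tau$ is a topology on $X$ such that each functional $\mathcal{R}_k\colon X\to[0,+\infty]$, $1\le k\le n$, is sequentially coercive and lower semi-continuous with respect to $\tau$. Let $\{y^{(l)}\}_{l\in\mathbb{N}}\subset Y$ be any sequence converging to $y^\delta\in Y$ with respect to $\sigma$, let $\{F^{(l)}\}_{l\in\mathbb{N}}\subset\mathcal{F}(\tau)$ be any sequence converging to $F^\delta\in\mathcal{F}(\tau)$ with respect to $\tau$, let $\{\alpha^{(l)}\}_{l\in\mathbb{N}}\subset\mathbb{R}_{\ge 0}^n\setminus\{0\}$ converge to $\alpha\in\mathbb{R}_{\ge 0}^n\setminus\{0\}$, and for every $l\in\mathbb{N}$ let \[ x^{(l)}\in\operatorname{arg\,min}\{\mathcal{T}(x;\alpha^{(l)},y^{(l)},F^{(l)}) : x\in X\}. \] Then the sequence $\{x^{(l)}\}_{l\in\mathbb{N}}$ has a sub-sequence that converges with respect to $\tau$ to some \[ x_\alpha\in\operatorname{arg\,min}\{\mathcal{T}(x;\alpha,y^\delta,F^\delta) : x\in X\}. \]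
   Context: Setting: $X$ and $Y$ are sets, $n\ge 1$, $\mathcal{R}_k\colon X\to[0,+\infty]$ for $1\le k\le n$, and $\mathcal{S}\colon Y\times Y\to\mathbb{R}_{\ge 0}$ satisfies $\mathcal{S}(y,z)=0$ if and only if $y=z$. For $\alpha\in\mathbb{R}_{\ge 0}^n$, $y\in Y$ and $F\colon X\to Y$, the Tikhonov functional is \[ \mathcal{T}(x;\alpha,y,F)=\mathcal{S}(F(x),y)+\sum_{k=1}^n\alpha_k\mathcal{R}_k(x), \] with the convention $\alpha_k\mathcal{R}_k(x):=0$ if $\alpha_k=0$ and $\mathcal{R}_k(x)=+\infty$. Topology $\sigma$ on $Y$: the topology induced by the uniformity generated by the pseudo-metrics $d^{(z)}(y,\tilde y):=|\mathcal{S}(z,y)-\mathcal{S}(z,\tilde y)|$, $z\in Y$. Thus $y^{(l)}\to y$ with respect to $\sigma$ if and only if $\mathcal{S}(z,y^{(l)})\to\mathcal{S}(z,y)$ for every $z\in Y$. Sequential coercivity of $\mathcal{R}_k$ with respect to $\tau$ means that every sequence in $X$ on which $\mathcal{R}_k$ is bounded (from above by a finite constant) has a $\tau$-convergent sub-sequence (with limit in $X$). Joint domain: $\mathcal{D}:=\{x\in X : \mathcal{R}_k(x)<+\infty \text{ for all } 1\le k\le n\}$. It is assumed throughout that $\mathcal{D}\ne\emptyset$. Class $\mathcal{F}(\tau)$: the set of all mappings $F\colon X\to Y$ such that (i) the mapping $(x,y)\mapsto\mathcal{S}(F(x),y)$ is sequentially lower semi-continuous with respect to the product topology $\tau\times\sigma$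 on $X\times Y$; and (ii) for every $x\in X$ and every $y\in Y$ there exists a sequence $\{x^{(l)}\}_{l\in\mathbb{N}}\subset\mathcal{D}$ converging to $x$ with respect to $\tau$ such that $\mathcal{R}_k(x^{(l)})\to\mathcal{R}_k(x)$ for every $1\le k\le n$ and $\mathcal{S}(F(x^{(l)}),y)\to\mathcal{S}(F(x),y)$. Convergence of mappings: for $K\subset X$, $L\subset Y$ and $F,G\colon X\to Y$ let $d_{K,L}(F,G):=\sup\{|\mathcal{S}(F(x),z)-\mathcal{S}(G(x),z)| : x\in K,\ z\in L\}$. A sequence $F^{(l)}\colon X\to Y$ converges to $F\colon X\to Y$ with respect to $\tau$ if $d_{K,L}(F^{(l)},F)\to 0$ whenever $K\subset X$ is sequentially $\tau$-compact and $L\subset Y$ is sequentially $\sigma$-compact. *)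

(* Defs.v *)
From HB Require Import structures.
From mathcomp Require Import all_boot all_order all_algebra.
From mathcomp Require Import all_classical all_reals all_analysis.

Set Implicit Arguments.
Unset Strict Implicit.
Unset Printing Implicit Defensive.

Import Order.TTheory GRing.Theory Num.Theory.
Import numFieldNormedType.Exports.

Local Open Scope classical_set_scope.
Local Open Scope ring_scope.

(* The carrier [Y] with the supremum, over [z : Y], of the uniformities induced
   by [S z : Y -> R]; the library's pseudometric on [initial_topology (S z)] is
   [`|S z y - S z y'|], so this is the uniformity generated by the
   pseudometrics d^(z). *)
Definition sigma (R : realType) (Y : choiceType) (S : Y -> Y -> R) : Type :=
  sup_topology (fun z : Y => Uniform.on (initial_topology (S z))).

HB.instance Definition _ (R : realType) (Y : choiceType) (S : Y -> Y -> R) :=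
  Uniform.on (sigma S).

Lemma sigma_cvgP (R : realType) (Y : choiceType) (S : Y -> Y -> R)
    (y_ : nat -> sigma S) (y : sigma S) :
  (y_ l @[l --> \oo] --> y) <->
  (forall z : Y, S z (y_ l) @[l --> \oo] --> S z y).
Proof.
have FF : Filter (y_ @ \oo) by exact: fmap_filter.
pose Tc (z : Y) : Topological Y := Uniform.on (initial_topology (S z)).
have cvgE := @cvg_sup Y Y Tc (y_ @ \oo) y FF.
have [cvg_to_z cvg_of_z] := cvgE.
split=> [cy z|cy].
  move=> A nA; apply: (cvg_to_z cy z (S z @^-1` A)).
  exact: (@initial_continuous Y R (S z) y A nA).
apply: cvg_of_z => z A [_ [[B oB <-] By] BA].
have nB : nbhs (S z y) B by exact: open_nbhs_nbhs.
by apply: (@filterS _ _ FF (S z @^-1` B)) => //; exact: cy z B nB.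
Qed.

Definition argmin (R : realType) (T : Type) (f : T -> \bar R) : set T :=
  [set x | forall x', (f x <= f x')%E].

Definition seq_coercive (R : realType) (X : topologicalType) (f : X -> \bar R) :=
  forall u : nat -> X, (exists M : R, forall l, (f (u l) <= M%:E)%E) ->
  exists2 phi : nat -> nat, increasing_seq phi &
    exists x : X, u (phi l) @[l --> \oo] --> x.

Definition seq_lsc (R : realType) (X : topologicalType) (f : X -> \bar R) :=
  forall (u : nat -> X) (x : X), u l @[l --> \oo] --> x ->
  (f x <= limn_einf (fun l => f (u l)))%E.

Definition seq_compact (X : topologicalType) (K : set X) :=
  forall u : nat -> X, (forall l, K (u l)) ->
  exists2 phi : nat -> nat, increasing_seq phi &
    exists2 x : X, K x & u (phi l) @[l --> \oo] --> x.

(* The convention 0 * +oo = 0 is the one of [mule]. *)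
Definition tikhonov (R : realType) (n : nat) (X Y : Type)
    (Reg : 'I_n -> X -> \bar R) (S : Y -> Y -> R)
    (x : X) (alpha : 'rV[R]_n) (y : Y) (F : X -> Y) : \bar R :=
  ((S (F x) y)%:E + \sum_(k < n) (alpha ord0 k)%:E * Reg k x)%E.

Definition joint_domain (R : realType) (n : nat) (X : Type)
    (Reg : 'I_n -> X -> \bar R) : set X :=
  [set x | forall k, (Reg k x < +oo)%E].

Definition class_F (R : realType) (n : nat) (X : topologicalType)
    (Y : choiceType) (Reg : 'I_n -> X -> \bar R) (S : Y -> Y -> R) :
    set (X -> Y) :=
  [set F |
    seq_lsc (fun p : X * sigma S => (S (F p.1) p.2)%:E) /\
    forall (x : X) (y : Y), exists u : nat -> X,
      [/\ forall l, joint_domain Reg (u l),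
          u l @[l --> \oo] --> x,
          forall k, Reg k (u l) @[l --> \oo] --> Reg k x &
          S (F (u l)) y @[l --> \oo] --> S (F x) y] ].

(* The supremum is taken in [0, +oo]: adding 0 makes the distance 0 rather than
   -oo when [K] or [L] is empty, and changes nothing otherwise. *)
Definition dist_on (R : realType) (X Y : Type) (S : Y -> Y -> R)
    (K : set X) (L : set Y) (F G : X -> Y) : \bar R :=
  ereal_sup (0%E |` [set `|S (F x) z - S (G x) z|%:E | x in K & z in L]).

Definition cvg_map (R : realType) (X : topologicalType) (Y : choiceType)
    (S : Y -> Y -> R) (F_ : nat -> X -> Y) (F : X -> Y) :=
  forall (K : set X) (L : set Y),
    seq_compact K -> seq_compact (L : set (sigma S)) ->
    dist_on S K L (F_ l) F @[l --> \oo] --> 0%E.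

(* Main.v *)
Require Import Defs.
From mathcomp Require Import all_boot all_order all_algebra.
From mathcomp Require Import all_classical all_reals all_analysis.
From mathcomp Require Import lra.

Import Order.TTheory GRing.Theory Num.Theory.
Import numFieldNormedType.Exports.

Local Open Scope classical_set_scope.
Local Open Scope ring_scope.

(** Fix an index k0 with alpha_k0 > 0 and a point x0 of the joint domain.
    Minimality of x_l against x0 gives
      alpha_{l,k0} R_k0(x_l) <= T(x0; alpha_l, y_l, F_l),
    and the right-hand side converges to a finite value (cvg_tikhonov), so
    R_k0(x_l) is eventually bounded and coercivity yields a sub-sequence
    converging to some x.

    The Tikhonov functional is lower semi-continuous in all arguments jointly:
    T(x; alpha, ydelta, Fdelta) <= liminf T(x_l; alpha_l, y_l, F_l) along this
    sub-sequence (liminf_ge_tikhonov).  The point is that F_l converges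
    continuously, i.e. S(F_l x_l, y_l) - S(Fdelta x_l, y_l) -> 0 whenever
    x_l -> x and y_l -> ydelta (cvg_map_diag), since a convergent sequence
    together with its limit is sequentially compact (seq_compact_cvg_seq); the
    rest is lower semi-continuity of S(Fdelta _, _) and of the R_k.

    Write T_l for T(_; alpha_l, y_l, F_l) and T for T(_; alpha, ydelta, Fdelta).
    For every x' of the joint domain the two facts combine to
      T(x) <= liminf T_l(x_l) <= lim T_l(x') = T(x'),
    and the approximation property of the class F(tau) extends T(x) <= T(x') to
    all x' (argmin_tikhonov_domain). *)

(** * Sub-sequences and sequentially compact sets *)

Lemma increasing_seq_cvg (phi : nat -> nat) :
  increasing_seq phi -> phi @ \oo --> \oo.
Proof.
move=> phi_incr A [N _ NA].
have phi_ge m : (m <= phi m)%N.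
  elim: m => // m IHm; apply: (leq_ltn_trans IHm).
  by rewrite (leqW_mono phi_incr).
by exists N => // m /= Nm; apply: NA => /=; exact: leq_trans Nm (phi_ge m).
Qed.

(** A convergent sequence together with one of its limits is sequentially
    compact; no separation axiom is needed. *)
Lemma seq_compact_cvg_seq (T : topologicalType) (u : nat -> T) (x : T) :
  u l @[l --> \oo] --> x -> seq_compact (range u `|` [set x]).
Proof.
move=> ux v vK.
have [[p [Kp vp]]|rare] := pselect (exists p, (range u `|` [set x]) p /\
    infinite_set [set l | v l = p]).
  have [|phi [phi_incr _ phiP]] := infinite_increasing_seq_wf _ vp 0%N.
    by move=> m; apply: sub_finite_set (finite_II m.+1) => k /=.
  exists phi => //; exists p => //.
  have -> : (fun l => v (phi l)) = cst p by apply/funext => l; exact: phiP.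
  exact: cvg_cst.
(* Otherwise every value is taken finitely often, so v itself converges to x. *)
have avoid p : (range u `|` [set x]) p -> \forall l \near \oo, v l <> p.
  move=> Kp; have : finite_set [set l | v l = p].
    by apply: contrapT => vp; apply: rare; exists p.
  move=> /finite_seqP[s sE]; exists (\max_(i <- s) i).+1 => // l /= sl vl.
  have : l \in s by have : [set l | v l = p] l by []; rewrite sE.
  by move=> ls; move: sl; rewrite ltnNge leq_bigmax_seq.
have avoid_init M : \forall l \near \oo, forall j, (j < M)%N -> v l <> u j.
  elim: M => [|M IHM]; first by near=> l => j; rewrite ltn0.
  have KM : (range u `|` [set x]) (u M) by left; exists M.
  near=> l => j; rewrite ltnS leq_eqVlt => /orP[/eqP ->|jM].
    by near: l; exact: avoid.
  by move: j jM; near: l.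
exists id => //; exists x; first by right.
move=> U xU; have [M _ MU] := ux U xU.
suff : \forall l \near \oo, U (v l) by [].
near=> l; have [[j _ uj]|->] := vK l; last exact: nbhs_singleton.
have /= := MU j; rewrite uj; apply; rewrite leqNgt; apply/negP => jM.
have /(_ j jM) : forall j, (j < M)%N -> v l <> u j by near: l.
by rewrite uj.
Unshelve. all: by end_near. Qed.

(** * Lower limits of sequences of extended reals *)

Section ereal_liminf.
Context {R : realType}.
Implicit Types (u v : nat -> \bar R) (a b : \bar R).
Local Open Scope ereal_scope.

(** The inequality a <= liminf u: every real number below a is eventually below
    u.  This form avoids the infima over tails, so that sums and products reduce
    to inequalities between real numbers. *)
Definition liminf_ge u a :=
  forall c : R, c%:E < a -> \forall l \near \oo, c%:E < u l.

Lemma lte_real_dense (c : R) a :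
  c%:E < a -> exists2 d : R, (c < d)%R & d%:E < a.
Proof.
case: a => [r||] //.
- by rewrite lte_fin => cr; exists ((c + r) / 2)%R; rewrite ?lte_fin; lra.
- by move=> _; exists (c + 1)%R; rewrite ?ltry// ltrDl.
Qed.

Lemma lee_real_lower a b : (forall c : R, c%:E < a -> c%:E <= b) -> a <= b.
Proof.
move=> ab; rewrite leNgt; apply/negP; case: b ab => [b||] ab.
- by move=> /lte_real_dense[d bd /ab]; rewrite lee_fin leNgt bd.
- by rewrite ltNge leey.
- case: a ab => [a||] ab //.
  + have : (a - 1)%:E < a%:E by rewrite lte_fin ltrBlDr ltrDl.
    by move=> /ab.
  + by move=> _; have /ab : 0%R%:E < +oo :> \bar R by exact: ltry.
Qed.

Lemma liminf_ge_limn_einf u a : a <= limn_einf u -> liminf_ge u a.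
Proof.
move=> au c /lt_le_trans/(_ au).
have -> : limn_einf u = ereal_sup (range (einfs u)).
  by rewrite limn_einf_lim; apply/cvg_lim => //; exact: cvg_einfs_sup.
move=> /ereal_sup_gt[_ [N _ <-] cN].
exists N => // m /= Nm; apply: (lt_le_trans cN).
by apply: ereal_inf_lbound; exists m.
Qed.

Lemma liminf_ge0 u : (forall l, 0 <= u l) -> liminf_ge u 0.
Proof. by move=> u0 c c0; apply: nearW => l; exact: lt_le_trans c0 (u0 l). Qed.

Lemma liminf_ge_le_cvg u v a b : liminf_ge u a ->
  (forall l, u l <= v l) -> v @ \oo --> b -> a <= b.
Proof.
move=> ua uv vb; apply: lee_real_lower => c /ua cu.
apply: (cvge_to_ge vb); apply: filterS cu => l cul.
exact/ltW/(lt_le_trans cul).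
Qed.

Lemma liminf_geD u v a b : 0 <= a -> 0 <= b ->
  liminf_ge u a -> liminf_ge v b -> liminf_ge (fun l => u l + v l) (a + b).
Proof.
move=> a0 b0 ua vb c cab.
have [c1 [c2 [c1a c2b cE]]] :
    exists c1 c2 : R, [/\ c1%:E < a, c2%:E < b & (c = c1 + c2)%R].
  case: a b a0 b0 cab {ua vb} => [a||] [b||] //= _ _; last first.
  - by move=> _; exists 0%R, c; rewrite add0r !ltry.
  - move=> _; exists (c - (b - 1))%R, (b - 1)%R.
    by rewrite ltry lte_fin; split=> //; lra.
  - move=> _; exists (a - 1)%R, (c - (a - 1))%R.
    by rewrite ltry lte_fin; split=> //; lra.
  rewrite -EFinD lte_fin => cab.
  exists (a - (a + b - c) / 2)%R, (b - (a + b - c) / 2)%R.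
  by rewrite !lte_fin; split; lra.
by near=> l; rewrite cE EFinD lteD//; near: l; [exact: ua|exact: vb].
Unshelve. all: by end_near. Qed.

Lemma liminf_ge_sum (I : Type) (r : seq I) (u : I -> nat -> \bar R)
    (a : I -> \bar R) : (forall i, 0 <= a i) ->
  (forall i, liminf_ge (u i) (a i)) ->
  liminf_ge (fun l => \sum_(i <- r) u i l) (\sum_(i <- r) a i).
Proof.
move=> a0 ua; elim: r => [|i r IHr].
  by under eq_fun do rewrite big_nil; rewrite big_nil; exact: liminf_ge0.
under eq_fun do rewrite big_cons; rewrite big_cons.
by apply: liminf_geD => //; exact: sume_ge0.
Qed.

(** When the limit of the coefficients vanishes, the bound reduces to 0 by the
    convention 0 * +oo = 0. *)
Lemma liminf_geM (t : nat -> R) (s : R) u a :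
  (forall l, 0 <= t l)%R -> (0 <= s)%R -> (forall l, 0 <= u l) ->
  t l @[l --> \oo] --> s -> liminf_ge u a ->
  liminf_ge (fun l => (t l)%:E * u l) (s%:E * a).
Proof.
move=> t0 s0 u0 ts ua.
have tu0 : liminf_ge (fun l => (t l)%:E * u l) 0.
  by apply: liminf_ge0 => l; rewrite mule_ge0 ?lee_fin.
move: s0; rewrite le_eqVlt => /predU1P[<-|s0]; first by rewrite mul0e.
move=> c csa; have [c0|c0] := ltP c 0%R; first by apply: tu0; rewrite lte_fin.
have /lte_real_dense[d cd da] : (c / s)%:E < a.
  by rewrite ltNge mulrC EFinM lee_pdivlMl// -ltNge.
move: cd; rewrite ltr_pdivrMr// => cds.
have ctd : \forall l \near \oo, (c < t l * d)%R.
  have : (fun l => t l * d)%R @ \oo --> (s * d)%R by exact: cvgMl.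
  by move=> /cvgr_gt; apply; rewrite mulrC.
near=> l; apply: (@lt_le_trans _ _ (t l * d)%:E).
  by rewrite lte_fin; near: l.
rewrite EFinM lee_wpmul2l ?lee_fin//; apply/ltW.
by near: l; exact: ua.
Unshelve. all: by end_near. Qed.

(** A real perturbation that tends to 0 does not affect a lower bound on the
    lower limit. *)
Lemma liminf_ge_perturb (f g : nat -> R) a :
  liminf_ge (fun l => (f l)%:E) a -> (g l - f l)%R @[l --> \oo] --> 0%R ->
  liminf_ge (fun l => (g l)%:E) a.
Proof.
move=> fa gf c /lte_real_dense[d cd /fa df].
have gfd : \forall l \near \oo, (c - d < g l - f l)%R.
  by apply: (cvgr_gt _ gf); rewrite subr_lt0.
near=> l.
have cdgf : (c - d < g l - f l)%R by near: l.
have : d%:E < (f l)%:E by near: l.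
by rewrite !lte_fin => dfl; lra.
Unshelve. all: by end_near. Qed.

End ereal_liminf.

(** * Convergence and lower semi-continuity of the Tikhonov functional *)

Lemma cvg_row_coord (R : realType) (n : nat) (alpha_ : nat -> 'rV[R]_n)
    (alpha : 'rV[R]_n) (k : 'I_n) :
  alpha_ l @[l --> \oo] --> alpha ->
  alpha_ l ord0 k @[l --> \oo] --> alpha ord0 k.
Proof.
move=> alpha_cvg.
apply: (@cvg_comp _ _ _ alpha_ (fun M : 'rV[R]_n => M ord0 k) _ _ _ alpha_cvg).
exact: (@coord_continuous R 1 n ord0 k alpha).
Qed.

(** Continuous convergence: the sets K and L in the definition of convergence
    of mappings are the ranges of the two sequences with their limits. *)
Lemma cvg_map_diag (R : realType) (X : topologicalType) (Y : choiceType)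
    (S : Y -> Y -> R) (F_ : nat -> X -> Y) (F : X -> Y)
    (x_ : nat -> X) (x : X) (y_ : nat -> sigma S) (y : sigma S) :
  cvg_map S F_ F -> x_ l @[l --> \oo] --> x -> y_ l @[l --> \oo] --> y ->
  S (F_ l (x_ l)) (y_ l) - S (F (x_ l)) (y_ l) @[l --> \oo] --> 0.
Proof.
move=> FF xx yy.
have dist0 := FF _ _ (seq_compact_cvg_seq _ _ _ xx)
  (seq_compact_cvg_seq _ _ _ yy).
have [dist_fin fine_dist0] := (fine_cvgP _ _).1 dist0.
apply/cvgr0Pnorm_lt => e e0.
near=> l; apply: (@le_lt_trans _ _
    (fine (dist_on S (range x_ `|` [set x]) (range y_ `|` [set y]) (F_ l) F))).
  rewrite -lee_fin fineK; last by near: l.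
  apply: ereal_sup_ubound; right; exists (x_ l); first by left; exists l.
  by exists (y_ l) => //; left; exists l.
by near: l; exact: cvgr_lt fine_dist0 _ e0.
Unshelve. all: by end_near. Qed.

Section tikhonov.
Context (R : realType) (n : nat) (X : topologicalType) (Y : choiceType).
Context (Reg : 'I_n -> X -> \bar R) (S : Y -> Y -> R).
Hypotheses (Reg_ge0 : forall k x, (0 <= Reg k x)%E).
Hypotheses (S_ge0 : forall y z, 0 <= S y z).

Lemma cvg_tikhonov (F_ : nat -> X -> Y) (F : X -> Y) (y_ : nat -> sigma S)
    (y : sigma S) (alpha_ : nat -> 'rV[R]_n) (alpha : 'rV[R]_n) (x : X) :
  cvg_map S F_ F -> y_ l @[l --> \oo] --> y ->
  alpha_ l @[l --> \oo] --> alpha ->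
  (forall l k, 0 <= alpha_ l ord0 k) -> joint_domain Reg x ->
  tikhonov Reg S x (alpha_ l) (y_ l) (F_ l) @[l --> \oo] -->
    tikhonov Reg S x alpha y F.
Proof.
move=> FF yy aa a0 xD; apply: cvgeD; first by rewrite fin_num_adde_defr.
- apply: cvg_EFin; first exact: nearW.
  have diff0 : S (F_ l x) (y_ l) - S (F x) (y_ l) @[l --> \oo] --> 0.
    exact: (cvg_map_diag _ _ _ _ _ _ _ _ _ _ FF (cvg_cst x) yy).
  have Fxy := (sigma_cvgP _ _).1 yy (F x).
  rewrite -[S (F x) y]add0r.
  have -> : fine \o (fun l => (S (F_ l x) (y_ l))%:E) =
      (fun l => S (F_ l x) (y_ l) - S (F x) (y_ l) + S (F x) (y_ l)).
    by apply/funext => l /=; rewrite subrK.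
  exact: cvgD diff0 Fxy.
- apply: cvg_nnesum => k _.
    by apply: nearW => l; rewrite mule_ge0 ?lee_fin.
  apply: cvgeZr; first by rewrite ge0_fin_numE.
  by apply: cvg_EFin; [exact: nearW|exact: cvg_row_coord].
Qed.

Lemma liminf_ge_tikhonov (F_ : nat -> X -> Y) (F : X -> Y)
    (y_ : nat -> sigma S) (y : sigma S) (alpha_ : nat -> 'rV[R]_n)
    (alpha : 'rV[R]_n) (x_ : nat -> X) (x : X) :
  (forall k, seq_lsc (Reg k)) ->
  seq_lsc (fun p : X * sigma S => (S (F p.1) p.2)%:E) ->
  cvg_map S F_ F -> y_ l @[l --> \oo] --> y ->
  alpha_ l @[l --> \oo] --> alpha ->
  (forall l k, 0 <= alpha_ l ord0 k) -> (forall k, 0 <= alpha ord0 k) ->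
  x_ l @[l --> \oo] --> x ->
  liminf_ge (fun l => tikhonov Reg S (x_ l) (alpha_ l) (y_ l) (F_ l))
    (tikhonov Reg S x alpha y F).
Proof.
move=> Reg_lsc F_lsc FF yy aa a_ge0 a0 xx; apply: liminf_geD.
- by rewrite lee_fin.
- by apply: sume_ge0 => k _; rewrite mule_ge0 ?lee_fin.
- apply: liminf_ge_perturb (cvg_map_diag _ _ _ _ _ _ _ _ _ _ FF xx yy).
  apply: liminf_ge_limn_einf.
  exact: (F_lsc (fun l => (x_ l, y_ l)) (x, y) (cvg_pair xx yy)).
- apply: liminf_ge_sum => k; first by rewrite mule_ge0 ?lee_fin.
  apply: liminf_geM => //; first exact: cvg_row_coord.
  exact/liminf_ge_limn_einf/Reg_lsc.
Qed.

(** Points outside the joint domain are handled by the approximation property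
    of the class F(tau). *)
Lemma argmin_tikhonov_domain (F : X -> Y) (y : Y) (alpha : 'rV[R]_n) (x : X) :
  class_F Reg S F -> (forall k, 0 <= alpha ord0 k) ->
  (forall x', joint_domain Reg x' ->
    (tikhonov Reg S x alpha y F <= tikhonov Reg S x' alpha y F)%E) ->
  argmin (fun x' => tikhonov Reg S x' alpha y F) x.
Proof.
move=> [_ F_approx] a0 x_min x'.
have [u [uD _ Reg_u Su]] := F_approx x' y.
have : tikhonov Reg S (u l) alpha y F @[l --> \oo] -->
    tikhonov Reg S x' alpha y F.
  apply: cvgeD; first by rewrite fin_num_adde_defr.
    by apply: cvg_EFin; [exact: nearW|].
  apply: cvg_nnesum => k _; last exact: cvgeZl.
  by apply: nearW => l; rewrite mule_ge0 ?lee_fin.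
by move=> /cvge_to_ge; apply; apply: nearW => l; exact: x_min.
Qed.

End tikhonov.

(** * Stability of the minimizers *)

Theorem proposition3p2 (R : realType) (n : nat) (hn : (1 <= n)%N)
    (X : topologicalType) (Y : choiceType)
    (Reg : 'I_n -> X -> \bar R) (Reg_ge0 : forall k x, (0 <= Reg k x)%E)
    (S : Y -> Y -> R) (S_ge0 : forall y z, 0 <= S y z)
    (S_eq0 : forall y z, S y z = 0 <-> y = z)
    (domain_neq0 : joint_domain Reg !=set0)
    (Reg_coercive : forall k, seq_coercive (Reg k))
    (Reg_lsc : forall k, seq_lsc (Reg k))
    (y_ : nat -> Y) (ydelta : Y)
    (cvg_y : (y_ : nat -> sigma S) l @[l --> \oo] --> (ydelta : sigma S))
    (F_ : nat -> X -> Y) (Fdelta : X -> Y)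
    (F_class : forall l, class_F Reg S (F_ l))
    (Fdelta_class : class_F Reg S Fdelta)
    (cvg_F : cvg_map S F_ Fdelta)
    (alpha_ : nat -> 'rV[R]_n) (alpha : 'rV[R]_n)
    (alpha_ge0_ : forall l k, 0 <= alpha_ l ord0 k)
    (alpha_neq0_ : forall l, alpha_ l != 0)
    (alpha_ge0 : forall k, 0 <= alpha ord0 k)
    (alpha_neq0 : alpha != 0)
    (cvg_alpha : alpha_ l @[l --> \oo] --> alpha)
    (x_ : nat -> X)
    (x_argmin : forall l,
       argmin (fun x => tikhonov Reg S x (alpha_ l) (y_ l) (F_ l)) (x_ l)) :
  exists2 phi : nat -> nat, increasing_seq phi &
    exists2 xalpha : X,
      argmin (fun x => tikhonov Reg S x alpha ydelta Fdelta) xalpha &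
      x_ (phi l) @[l --> \oo] --> xalpha.
Proof.
have [x0 x0D] := domain_neq0.
have cvg_T x' : joint_domain Reg x' ->
    tikhonov Reg S x' (alpha_ l) (y_ l) (F_ l) @[l --> \oo] -->
    tikhonov Reg S x' alpha ydelta Fdelta.
  by move=> x'D; exact: cvg_tikhonov.
have [k ak0] : exists k, 0 < alpha ord0 k.
  have /rV0Pn[k ak] := alpha_neq0.
  by exists k; rewrite lt0r ak alpha_ge0.
have [M [N RegM]] : exists M : R, exists N,
    forall l, (N <= l)%N -> (Reg k (x_ l) <= M%:E)%E.
  have T0_fin : tikhonov Reg S x0 alpha ydelta Fdelta \is a fin_num.
    rewrite fin_numD /=; apply/sum_fin_numP => j _ _.
    by rewrite fin_numM// ge0_fin_numE.
  pose T0 := fine (tikhonov Reg S x0 alpha ydelta Fdelta).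
  have := cvg_T _ x0D; rewrite -(fineK T0_fin) -/T0 => /fine_cvgP[Tfin Tcvg].
  have Tlt : \forall l \near \oo,
      fine (tikhonov Reg S x0 (alpha_ l) (y_ l) (F_ l)) < T0 + 1.
    by apply: (cvgr_lt _ Tcvg); rewrite ltrDl.
  have alt : \forall l \near \oo, alpha ord0 k / 2 < alpha_ l ord0 k.
    by apply: (cvgr_gt _ (cvg_row_coord _ _ _ _ k cvg_alpha)); lra.
  suff [N _ NP] : \forall l \near \oo,
      (Reg k (x_ l) <= ((alpha ord0 k / 2)^-1 * (T0 + 1))%:E)%E.
    by exists ((alpha ord0 k / 2)^-1 * (T0 + 1)), N.
  near=> l.
  rewrite EFinM lee_pdivlMl ?divr_gt0//.
  apply: (@le_trans _ _ ((alpha_ l ord0 k)%:E * Reg k (x_ l))%E).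
    by rewrite lee_wpmul2r// lee_fin ltW//; near: l.
  apply: (@le_trans _ _ (tikhonov Reg S (x_ l) (alpha_ l) (y_ l) (F_ l))).
    rewrite /tikhonov (bigD1 k)//= addeCA leeDl// adde_ge0 ?lee_fin//.
    by apply: sume_ge0 => j _; rewrite mule_ge0 ?lee_fin.
  apply: (le_trans (x_argmin l x0)).
  rewrite -[leLHS]fineK; last by near: l.
  by rewrite lee_fin ltW//; near: l.
(* The bound only holds from the rank N on, hence the shift by N. *)
have [|phi phi_incr [x phi_x]] := Reg_coercive k (fun l => x_ (l + N)%N).
  by exists M => l; apply: RegM; exact: leq_addl.
pose psi l := (phi l + N)%N.
have psi_incr : increasing_seq psi.
  by move=> i j; rewrite /psi leEnat leq_add2r; exact: phi_incr.
exists psi => //; exists x => //.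
have sub (T : topologicalType) (u : nat -> T) (t : T) :
    u l @[l --> \oo] --> t -> u (psi l) @[l --> \oo] --> t.
  move=> ut; apply: cvg_trans ut.
  exact: (cvg_app u (increasing_seq_cvg _ psi_incr)).
have Fsub : cvg_map S (fun l => F_ (psi l)) Fdelta.
  by move=> K L Kc Lc; exact: (sub _ _ _ (cvg_F _ _ Kc Lc)).
apply: argmin_tikhonov_domain => // x' x'D.
have [F_lsc _] := Fdelta_class.
apply: (liminf_ge_le_cvg (fun l =>
    tikhonov Reg S (x_ (psi l)) (alpha_ (psi l)) (y_ (psi l)) (F_ (psi l)))).
- by apply: (liminf_ge_tikhonov _ _ _ _ _ _ _ _ _ _ _ _ _ _ _ _ Reg_lsc F_lsc
    Fsub (sub _ _ _ cvg_y) (sub _ _ _ cvg_alpha)).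
- by move=> l; exact: x_argmin.
- exact: (sub _ _ _ (cvg_T _ x'D)).
Unshelve. all: by end_near. Qed.
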